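(* Let $f\in\mathbb{R}^N$ be a signal on the point cloud. Then for every $\alpha\in\mathbb{R}$, $$\bigl\|\hat f^{(\alpha)}\bigr\|_2=\bigl\|B^{1/2}f\bigr\|_2\le\bigl\|B^{1/2}\bigr\|_2\,\|f\|_2 .$$ Thus the PMFHT $f\mapsto\hat f^{(\alpha)}$ is a bounded linear operator. Furthermore, $\|\hat f^{(\alpha)}\|_2=\|B^{1/2}f\|_2=\sqrt{f^\top Bf}=\|f\|_B$, so that it acts as an isometry from the spatial domain (with norm $\|\cdot\|_B$) to the fractional spectral domain (with the Euclidean norm).
   Context: Discrete Laplace–Beltrami data. Let $P=\{p_1,\dots,p_N\}\subset\mathbb{R}^3$ be a point cloud sampled from a surface and let $t>0$. For each $i$, let $\hat T_{p_i}$ be the estimated tangent plane at $p_i$ (best-fitting plane to the points of $P$ in a ball around $p_i$), and let $b_{ii}>0$ be the area of the Voronoi cell of $p_i$ in the planar Voronoi diagram, on $\hat T_{p_i}$, of the projections of the points of $P$ in a ball $B(p_i,\delta)$. Let $B=\mathrm{diag}(b_{11},\dots,b_{NN})$ (mass matrix) and let $Q$ be the real symmetric matrix with $q_{ij}=\frac{b_{ii}b_{jj}}{4\pi t^2}\exp(-\|p_i-p_j\|^2/(4t))$ for $i\ne j$ and $q_{ii}=-\sum_{j\neq i}q_{ij}$. Let $H\in\mathbb{R}^{N\times N}$ be a matrix whose columns $H_i$ are generalized eigenvectors, $QH_i=-\lambda_i BH_i$, normalized so that $H^\top BH=I$. Fractional transform. Put $F_M:=H^\top B^{1/2}$, a real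 orthogonal matrix. Fix a spectral decomposition $F_M=V\Omega V^*$ with $V$ unitary and $\Omega=\mathrm{diag}(\omega_1,\dots,\omega_N)$, $|\omega_i|=1$. For $\alpha\in\mathbb{R}$ put $F_M^{(\alpha)}:=V\Omega^\alpha V^*$ with $\Omega^\alpha=\mathrm{diag}(\omega_1^\alpha,\dots,\omega_N^\alpha)$, where $\omega_i^\alpha:=e^{\mathrm{i}\alpha\theta_i}$ for a choice of real argument $\theta_i$ of $\omega_i$ fixed once for all $\alpha$. The point cloud manifold fractional harmonic transform (PMFHT) of order $\alpha$ of a signal $f$ is $\hat f^{(\alpha)}:=F_M^{(\alpha)}(B^{1/2}f)\in\mathbb{C}^N$. The norm $\|\cdot\|_2$ is the Euclidean norm on vectors and the spectral (operator) norm on matrices; $\|f\|_B:=\sqrt{f^\top Bf}$. *)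

(* Defs.v *)
From HB Require Import structures.
From mathcomp Require Import all_boot all_order all_algebra.
From mathcomp Require Import all_classical all_reals all_analysis.
From mathcomp Require Import complex.
From mathcomp Require Import spectral sesquilinear.

Set Implicit Arguments.
Unset Strict Implicit.
Unset Printing Implicit Defensive.

Import Order.TTheory GRing.Theory Num.Theory.

Local Open Scope classical_set_scope.
Local Open Scope ring_scope.
Local Open Scope complex_scope.
Local Open Scope sesquilinear_scope.

Section Norms.
Variable R : realType.

(* The norm that the library puts on matrices is the sup norm, hence these. *)
Definition enorm n (v : 'cV[R]_n) : R := Num.sqrt (\sum_i v i 0 ^+ 2).

(* [Normc.normc] is the R-valued modulus of a complex number. *)
Definition enormC n (v : 'cV[R[i]]_n) : R :=
  Num.sqrt (\sum_i ComplexField.Normc.normc (v i 0) ^+ 2).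

Definition opnorm n (A : 'M[R]_n) : R :=
  sup [set enorm (A *m x) | x in [set x : 'cV[R]_n | enorm x <= 1]].

Definition cis (x : R) : R[i] := cos x +i* sin x.

Definition complexify m n (A : 'M[R]_(m, n)) : 'M[R[i]]_(m, n) :=
  map_mx (real_complex R) A.

End Norms.

Section PointCloud.
Variables (R : realType) (N : nat) (p : 'I_N -> 'cV[R]_3).

Definition in_ball (i : 'I_N) (r : R) (j : 'I_N) : bool :=
  enorm (p j - p i) < r.

(* A plane through p i is represented by an orthonormal frame U of its
   direction, so that U^T *m (x - p i) are the planar coordinates of the
   orthogonal projection of x on it. *)
Definition orthonormal_frame (U : 'M[R]_(3, 2)) : Prop := U^T *m U = 1%:M.

Definition planar_coord (i : 'I_N) (U : 'M[R]_(3, 2)) (x : 'cV[R]_3) :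
  'cV[R]_2 := U^T *m (x - p i).

Definition dist_plane (i : 'I_N) (U : 'M[R]_(3, 2)) (x : 'cV[R]_3) : R :=
  enorm (x - p i - U *m planar_coord i U x).

Definition fit_error (i : 'I_N) (r : R) (U : 'M[R]_(3, 2)) : R :=
  \sum_(j | in_ball i r j) dist_plane i U (p j) ^+ 2.

(* The estimated tangent plane at p i: the plane through p i that fits best, in
   the least-squares sense, the points of the cloud at distance < r of p i. *)
Definition tangent_plane (i : 'I_N) (r : R) (U : 'M[R]_(3, 2)) : Prop :=
  orthonormal_frame U /\
  forall U' : 'M[R]_(3, 2),
    orthonormal_frame U' -> fit_error i r U <= fit_error i r U'.

Definition plane_point (y : R * R) : 'cV[R]_2 :=
  \col_(k < 2) (if k == 0 then y.1 else y.2).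

(* The cell of p i itself, whose planar coordinates are 0. *)
Definition voronoi_cell (i : 'I_N) (U : 'M[R]_(3, 2)) (delta : R) :
    set (R * R) :=
  [set y | forall j : 'I_N, in_ball i delta j ->
     enorm (plane_point y - planar_coord i U (p i)) <=
     enorm (plane_point y - planar_coord i U (p j))].

Definition planar_area (A : set (R * R)) : \bar R :=
  (@lebesgue_measure R \x @lebesgue_measure R)%E A.

Definition lb_weight (t : R) (b : 'I_N -> R) (i j : 'I_N) : R :=
  b i * b j / (4 * pi * t ^+ 2) * expR (- (enorm (p i - p j) ^+ 2) / (4 * t)).

Definition stiffness_mx (t : R) (b : 'I_N -> R) : 'M[R]_N :=
  \matrix_(i, j) if i == j then - \sum_(k | k != i) lb_weight t b i k
                 else lb_weight t b i j.

End PointCloud.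

Section Transform.
Variables (R : realType) (N : nat).

Definition mass_mx (b : 'I_N -> R) : 'M[R]_N := diag_mx (\row_i b i).

Definition sqrt_mass_mx (b : 'I_N -> R) : 'M[R]_N :=
  diag_mx (\row_i Num.sqrt (b i)).

Definition bnorm (b : 'I_N -> R) (f : 'cV[R]_N) : R :=
  Num.sqrt ((f^T *m mass_mx b *m f) 0 0).

Definition harmonic_mx (b : 'I_N -> R) (H : 'M[R]_N) : 'M[R]_N :=
  H^T *m sqrt_mass_mx b.

Definition spectral_decomposition (F : 'M[R]_N) (V : 'M[R[i]]_N)
    (omega : 'I_N -> R[i]) : Prop :=
  [/\ V \is unitarymx,
      forall i, `|omega i| = 1 &
      complexify F = V *m diag_mx (\row_i omega i) *m V^t*].

(* theta i is the chosen argument of the i-th eigenvalue. *)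
Definition frac_mx (V : 'M[R[i]]_N) (theta : 'I_N -> R) (alpha : R) :
  'M[R[i]]_N := V *m diag_mx (\row_i cis (alpha * theta i)) *m V^t*.

Definition pmfht (b : 'I_N -> R) (V : 'M[R[i]]_N) (theta : 'I_N -> R)
    (alpha : R) (f : 'cV[R]_N) : 'cV[R[i]]_N :=
  frac_mx V theta alpha *m complexify (sqrt_mass_mx b *m f).

End Transform.

(* Main.v *)
Require Import Defs.
From mathcomp Require Import all_boot all_order all_algebra.
From mathcomp Require Import all_classical all_reals all_analysis.
From mathcomp Require Import complex.
From mathcomp Require Import spectral sesquilinear.
Import Order.TTheory GRing.Theory Num.Theory.
Local Open Scope classical_set_scope.
Local Open Scope ring_scope.
Local Open Scope complex_scope.
Local Open Scope sesquilinear_scope.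

(** The Voronoi areas are positive, so [sqrt_mass_mx b] is a genuine square root
    of the mass matrix: [sqrt_mass_mxM]. Expanding the squared Euclidean norm
    of [sqrt_mass_mx b *m f] as a matrix product then gives the quadratic form
    [f^T *m mass_mx b *m f], which is the squared B-norm ([enorm_sqrt_mass]).

    The numbers [cis (alpha * theta i)] lie on the unit circle whatever the
    order [alpha], so [frac_mx V theta alpha] is a product of three unitary
    matrices ([frac_mx_unitary]). A unitary matrix preserves the Hermitian norm
    ([unitarymx_enormC]), and on real vectors the Hermitian norm is the Euclidean
    one ([enormC_complexify]). Hence the transform of [f] has the norm of
    [sqrt_mass_mx b *m f], and it is linear because it is a composite of matrix
    products and of the inclusion of the reals in the complex numbers; the
    isometry property for differences follows.

    The remaining inequality is the defining property of an operator norm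
    ([le_opnorm]). As [opnorm] is a supremum of reals, it dominates the members
    of its set only once that set is known to be bounded, which
    [enorm_mulmx_bounded] provides. *)

Section EuclideanNorm.
Context {R : realType} {n : nat}.
Implicit Types (v : 'cV[R]_n) (z : 'cV[R[i]]_n).

Lemma enorm_ge0 v : 0 <= enorm v.
Proof. exact: sqrtr_ge0. Qed.

Lemma enormZ (a : R) v : enorm (a *: v) = `|a| * enorm v.
Proof.
rewrite /enorm -sqrtr_sqr -sqrtrM ?sqr_ge0// mulr_sumr.
by congr Num.sqrt; apply: eq_bigr => i _; rewrite mxE exprMn.
Qed.

Lemma abs_coord_le_enorm v i : `|v i 0| <= enorm v.
Proof.
rewrite -sqrtr_sqr ler_wsqrtr// (bigD1 i)//= lerDl.
by rewrite sumr_ge0// => j _; rewrite sqr_ge0.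
Qed.

Lemma enormE v : enorm v = Num.sqrt ((v^T *m v) 0 0).
Proof.
by congr Num.sqrt; rewrite mxE; apply: eq_bigr => i _; rewrite mxE expr2.
Qed.

Lemma enormC_complexify v : enormC (complexify v) = enorm v.
Proof.
congr Num.sqrt; apply: eq_bigr => i _.
by rewrite mxE /= expr0n addr0 sqrtr_sqr real_normK ?num_real.
Qed.

(** This moves the real-valued norm into the ring of complex matrices, where
    unitarity can be used algebraically. *)
Lemma sqr_enormC z : (enormC z ^+ 2)%:C = (z^t* *m z) 0 0.
Proof.
rewrite sqr_sqrtr; last by rewrite sumr_ge0// => i _; rewrite sqr_ge0.
rewrite rmorph_sum mxE; apply: eq_bigr => i _ /=.
by rewrite !mxE mulrC -normCK rmorphXn.
Qed.

End EuclideanNorm.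

(** [U^t* *m U = 1] cancels inside the Hermitian square [z^t* *m U^t* *m U *m z];
    norms are nonnegative, so equal squares suffice. *)
Lemma unitarymx_enormC {R : realType} {n : nat} (U : 'M[R[i]]_n) z :
  U \is unitarymx -> enormC (U *m z) = enormC z.
Proof.
move=> Uu; apply: (@pexpIrn _ 2) => //; rewrite ?nnegrE ?sqrtr_ge0//.
apply: (@complexI R); rewrite !sqr_enormC.
by rewrite trmx_mul map_mxM mulmxA mulmxKtV.
Qed.

Section OperatorNorm.
Context {R : realType} {n : nat} (A : 'M[R]_n).

(** A crude constant suffices: each coordinate of [A *m x] is at most the
    corresponding absolute row sum of [A] times the Euclidean norm of [x]. *)
Lemma enorm_mulmx_bounded (x : 'cV[R]_n) :
  enorm (A *m x) <= enorm (\col_i \sum_j `|A i j|) * enorm x.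
Proof.
rewrite mulrC -[X in X * _]ger0_norm ?enorm_ge0// -enormZ.
rewrite ler_wsqrtr// ler_sum// => i _; rewrite !mxE.
rewrite -[leLHS]real_normK ?num_real// lerXn2r ?nnegrE//.
  by rewrite mulr_ge0 ?enorm_ge0 ?sumr_ge0.
apply: le_trans (ler_norm_sum _ _ _) _.
rewrite mulr_sumr ler_sum// => j _.
by rewrite normrM mulrC ler_wpM2r// abs_coord_le_enorm.
Qed.

(** Homogeneity reduces the bound to the unit ball, over which [opnorm] is the
    supremum. *)
Lemma le_opnorm (x : 'cV[R]_n) : enorm (A *m x) <= opnorm A * enorm x.
Proof.
have [x0|x0] := eqVneq (enorm x) 0.
  (* A vector of norm 0 cannot be normalized; its image also has norm 0. *)
  by have := enorm_mulmx_bounded x; rewrite x0 !mulr0.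
have xgt0 : 0 < enorm x by rewrite lt_def x0 enorm_ge0.
have norm_inv : `|(enorm x)^-1| = (enorm x)^-1.
  by rewrite ger0_norm ?invr_ge0 ?enorm_ge0.
(* After division by [enorm x], the left side is the norm of the image of the
   unit vector [(enorm x)^-1 *: x]. *)
rewrite -ler_pdivrMr// mulrC -[X in X * _]norm_inv -enormZ scalemxAr.
apply: ub_le_sup.
  exists (enorm (\col_i \sum_j `|A i j|)) => _ [y /= y1 <-].
  apply: le_trans (enorm_mulmx_bounded y) _.
  by rewrite ler_piMr ?enorm_ge0.
by exists ((enorm x)^-1 *: x) => //=; rewrite enormZ norm_inv mulVf.
Qed.

End OperatorNorm.

Section Mass.
Context {R : realType} {N : nat} {b : 'I_N -> R} (b_ge0 : forall i, 0 <= b i).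

Lemma sqrt_mass_mxM : sqrt_mass_mx b *m sqrt_mass_mx b = mass_mx b.
Proof.
rewrite mulmx_diag; congr diag_mx; apply/rowP => i.
by rewrite !mxE -expr2 sqr_sqrtr.
Qed.

Lemma enorm_sqrt_mass (f : 'cV[R]_N) : enorm (sqrt_mass_mx b *m f) = bnorm b f.
Proof.
by rewrite enormE trmx_mul tr_diag_mx mulmxA -(mulmxA f^T) sqrt_mass_mxM.
Qed.

End Mass.

Section Fractional.
Context {R : realType} {N : nat}.

Lemma cis_mul_conj (x : R) : cis x * (cis x)^* = 1.
Proof.
apply/eqP; rewrite eq_complex /=; apply/andP; split; apply/eqP.
  by rewrite mulrN opprK -!expr2 cos2Dsin2.
by rewrite mulrN [sin x * _]mulrC addNr.
Qed.

Lemma diag_cis_unitary (x : 'I_N -> R) :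
  diag_mx (\row_i cis (x i)) \is unitarymx.
Proof.
apply/unitarymxP; rewrite tr_diag_mx map_diag_mx mulmx_diag -diag_const_mx.
by congr diag_mx; apply/rowP => i; rewrite !mxE cis_mul_conj.
Qed.

(** Only the moduli of the diagonal entries matter, and raising a point of the
    unit circle to a real power only rotates it along the circle. *)
Lemma frac_mx_unitary {V : 'M[R[i]]_N} (theta : 'I_N -> R) (alpha : R) :
  V \is unitarymx -> frac_mx V theta alpha \is unitarymx.
Proof.
move=> Vu; rewrite !mul_unitarymx ?trmxC_unitary//.
exact: diag_cis_unitary.
Qed.

Context {b : 'I_N -> R} {V : 'M[R[i]]_N} {theta : 'I_N -> R} {alpha : R}.

Lemma pmfht_linear :
  linear_for (real_complex R \; *:%R) (pmfht b V theta alpha).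
Proof.
move=> a u v; rewrite /pmfht /= mulmxDr -scalemxAr.
by rewrite /complexify map_mxD map_mxZ mulmxDr -scalemxAr.
Qed.

Lemma enormC_pmfht (f : 'cV[R]_N) : V \is unitarymx ->
  enormC (pmfht b V theta alpha f) = enorm (sqrt_mass_mx b *m f).
Proof.
by move=> Vu; rewrite unitarymx_enormC ?frac_mx_unitary ?enormC_complexify.
Qed.

Lemma pmfhtB (f g : 'cV[R]_N) :
  pmfht b V theta alpha f - pmfht b V theta alpha g
    = pmfht b V theta alpha (f - g).
Proof. by rewrite /pmfht mulmxBr /complexify map_mxB mulmxBr. Qed.

End Fractional.

Theorem theorem2 (R : realType) (N : nat) (hN : (0 < N)%N)
  (* point cloud and discretization parameters *)
  (p : 'I_N -> 'cV[R]_3) (hp : injective p)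
  (t : R) (ht : 0 < t) (delta : R) (hdelta : 0 < delta)
  (r : 'I_N -> R) (hr : forall i, 0 < r i)
  (* estimated tangent planes and Voronoi areas *)
  (T : 'I_N -> 'M[R]_(3, 2)) (hT : forall i, tangent_plane p i (r i) (T i))
  (b : 'I_N -> R) (hb : forall i, 0 < b i)
  (hbT : forall i, planar_area (voronoi_cell p i (T i) delta) = (b i)%:E)
  (* normalized generalized eigenvectors *)
  (H : 'M[R]_N) (lambda : 'I_N -> R)
  (hH : forall i, stiffness_mx p t b *m col i H
                  = (- lambda i) *: (mass_mx b *m col i H))
  (hHB : H^T *m mass_mx b *m H = 1%:M)
  (* spectral decomposition and arguments of the eigenvalues *)
  (V : 'M[R[i]]_N) (omega : 'I_N -> R[i])
  (hV : spectral_decomposition (harmonic_mx b H) V omega)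
  (theta : 'I_N -> R) (htheta : forall i, omega i = cis (theta i)) :
  forall alpha : R,
    (forall f : 'cV[R]_N,
       enormC (pmfht b V theta alpha f) = enorm (sqrt_mass_mx b *m f) /\
       enorm (sqrt_mass_mx b *m f) <= opnorm (sqrt_mass_mx b) * enorm f) /\
    linear_for (real_complex R \; *:%R) (pmfht b V theta alpha) /\
    (exists M : R, forall f : 'cV[R]_N,
       enormC (pmfht b V theta alpha f) <= M * enorm f) /\
    (forall f : 'cV[R]_N,
       [/\ enormC (pmfht b V theta alpha f) = enorm (sqrt_mass_mx b *m f),
           enorm (sqrt_mass_mx b *m f)
             = Num.sqrt ((f^T *m mass_mx b *m f) 0 0) &
           Num.sqrt ((f^T *m mass_mx b *m f) 0 0) = bnorm b f]) /\
    (forall f g : 'cV[R]_N,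
       enormC (pmfht b V theta alpha f - pmfht b V theta alpha g)
         = bnorm b (f - g)).
Proof.
have [Vu _ _] := hV; move=> alpha.
have b_ge0 i : 0 <= b i by exact: ltW.
have isom f : enormC (pmfht b V theta alpha f) = enorm (sqrt_mass_mx b *m f).
  exact: enormC_pmfht.
split; [|split; [|split; [|split]]].
- by move=> f; split; [exact: isom | exact: le_opnorm].
- exact: pmfht_linear.
- by exists (opnorm (sqrt_mass_mx b)) => f; rewrite isom le_opnorm.
- by move=> f; split; [exact: isom | exact: enorm_sqrt_mass |].
- by move=> f g; rewrite pmfhtB isom enorm_sqrt_mass.
Qed.
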